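(* Let $\mathcal{A}$ be a real antisymmetric $n\times n$ matrix and $\alpha\in\mathbb{R}\setminus\{0\}$. If $\alpha>0$, then for all sufficiently large $K$ the region $\mathcal{R}_+(K)$ is forward invariant and the region $\mathcal{R}_-(K)$ is backward invariant under the soliton flow on $\mathbb{R}^n\times\mathbb{S}^{n-1}$. Moreover, for such $K$, if $(\mathbf{C}(s),\mathbf{T}(s))$ is an orbit of the soliton flow with $(\mathbf{C}(s),\mathbf{T}(s))\in\mathcal{R}_+(K)$ for all $s\geq0$, then \[ \mathbf{C}=e^{\sigma(\alpha+\mathcal{A})}\Gamma+\mathcal{O}(e^{-\alpha\sigma})\qquad(\sigma\to\infty) \] for some constant vector $\Gamma\neq0$. If $\alpha<0$, then there is a $K<\infty$ such that any orbit $(\mathbf{C}(s),\mathbf{T}(s))$ of the soliton flow that remains in $\mathcal{R}_-(K)$ for all $s\geq0$ satisfies \[ \mathbf{C}=e^{-\sigma(\alpha+\mathcal{A})}\Gamma+\mathcal{O}(e^{\alpha\sigma})\qquad(\sigma\to\infty) \] for some constant vector $\Gamma\neq0$. In both cases $\sigma$ is the parameter along the curve defined by $\sigma=\int\frac{ds}{\|\mathbf{a}(\mathbf{C}(s))\|}$.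
   Context: For a nonzero vector $\mathbf{u}$, $\mathfrak{p}_{\mathbf{u}}(\mathbf{w})=\mathbf{w}-\frac{\langle\mathbf{w},\mathbf{u}\rangle}{\|\mathbf{u}\|^2}\mathbf{u}$. The soliton flow (with $\mathbf{v}=0$) is the flow on $\mathbb{R}^n\times\mathbb{S}^{n-1}$ of the system $\mathbf{C}_s=\mathbf{T}$, $\mathbf{T}_s=\mathfrak{p}_{\mathbf{T}}[(\alpha+\mathcal{A})\mathbf{C}]$, where $\alpha$ stands for $\alpha$ times the identity. Put $\mathbf{a}=\mathbf{a}(\mathbf{C})=(\alpha+\mathcal{A})\mathbf{C}$, $\hat{\mathbf{a}}=\mathbf{a}/\|\mathbf{a}\|$, $\mu=\langle\hat{\mathbf{a}},\mathbf{T}\rangle$, $\nu=\|\mathbf{a}\|^4(1-\mu^2)$, and $\mathcal{R}_+(K)=\{(\mathbf{C},\mathbf{T}):\|\mathbf{a}\|\geq K,\ \nu\leq K,\ \mu>0\}$, $\mathcal{R}_-(K)=\{(\mathbf{C},\mathbf{T}):\|\mathbf{a}\|\geq K,\ \nu\leq K,\ \mu<0\}$. *)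

(* Defs.v *)
From HB Require Import structures.
From mathcomp Require Export all_boot all_order all_algebra.
From mathcomp Require Export all_classical all_reals all_analysis.
Export Order.TTheory GRing.Theory Num.Theory.
Export numFieldNormedType.Exports.

Set Implicit Arguments.
Unset Strict Implicit.
Unset Printing Implicit Defensive.

Local Open Scope classical_set_scope.
Local Open Scope ring_scope.

(* The library norm [`|v|] on matrices is the sup norm, which is equivalent to
   the Euclidean one: it gives the usual derivatives, limits and big-O, but the
   formulas below need the Euclidean norm itself. *)
Definition dotv (R : realType) (n : nat) (u v : 'cV[R]_n) : R :=
  \sum_(i < n) u i 0 * v i 0.

Definition enorm (R : realType) (n : nat) (u : 'cV[R]_n) : R :=
  Num.sqrt (dotv u u).

Definition proj_orth (R : realType) (n : nat) (u w : 'cV[R]_n) : 'cV[R]_n :=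
  w - (dotv w u / enorm u ^+ 2) *: u.

Definition expmx (R : realType) (n : nat) (M : 'M[R]_n) : 'M[R]_n :=
  limn (series (fun k : nat => (k`!%:R)^-1 *: M ^+ k)).

Section SolitonFlow.
Variables (R : realType) (n : nat) (alpha : R) (A : 'M[R]_n).
Implicit Types (C T : R -> 'cV[R]_n) (J : interval R).

Definition avec (c : 'cV[R]_n) : 'cV[R]_n := (alpha%:M + A) *m c.

Definition ahat (c : 'cV[R]_n) : 'cV[R]_n := (enorm (avec c))^-1 *: avec c.

Definition mu (c t : 'cV[R]_n) : R := dotv (ahat c) t.

Definition nu (c t : 'cV[R]_n) : R := enorm (avec c) ^+ 4 * (1 - mu c t ^+ 2).

(* The flow is complete, so its orbits are the solutions with
   [J = `]-oo, +oo[]; allowing any time interval [J] only makes statements about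
   all orbits more general, and independent of completeness. *)
Definition soliton_orbit J C T : Prop :=
  forall s : R, s \in J ->
    [/\ enorm (T s) = 1,
        is_derive s 1 C (T s) &
        is_derive s 1 T (proj_orth (T s) (avec (C s)))].

Definition region_plus (K : R) : set ('cV[R]_n * 'cV[R]_n) :=
  [set X | [/\ enorm X.2 = 1, K <= enorm (avec X.1),
               nu X.1 X.2 <= K & 0 < mu X.1 X.2]].

Definition region_minus (K : R) : set ('cV[R]_n * 'cV[R]_n) :=
  [set X | [/\ enorm X.2 = 1, K <= enorm (avec X.1),
               nu X.1 X.2 <= K & mu X.1 X.2 < 0]].

Definition forward_invariant (U : set ('cV[R]_n * 'cV[R]_n)) : Prop :=
  forall J C T, soliton_orbit J C T ->
    forall s0 s1 : R, s0 \in J -> s1 \in J -> s0 <= s1 ->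
      U (C s0, T s0) -> U (C s1, T s1).

Definition backward_invariant (U : set ('cV[R]_n * 'cV[R]_n)) : Prop :=
  forall J C T, soliton_orbit J C T ->
    forall s0 s1 : R, s0 \in J -> s1 \in J -> s1 <= s0 ->
      U (C s0, T s0) -> U (C s1, T s1).

(* [sigma] is one of the indefinite integrals of [1 / enorm (avec (C s))] on
   [s >= 0], the constant of integration being arbitrary. *)
Definition sigma_param C (sigma : R -> R) : Prop :=
  forall s : R, 0 <= s -> is_derive s 1 sigma (enorm (avec (C s)))^-1.

End SolitonFlow.

(* Main.v *)
Require Import Defs.
From mathcomp Require Import ring lra.

Set Implicit Arguments.
Unset Strict Implicit.
Unset Printing Implicit Defensive.

Local Open Scope classical_set_scope.
Local Open Scope ring_scope.

(** Write [a = (alpha + A) C], [r = |a|], [x = r ^ 2], [m = <a, T>],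
    [w = x - m ^ 2] (the squared norm of the part of [a] orthogonal to [T]) and
    [q = <a, A T>]. Where [r > 0], [nu = x w] and [mu] has the sign of [m].
    Since [A] is antisymmetric, the soliton system gives
      [x' = 2 (alpha m + q)],    [m' = alpha + w],
      [(x w)' = 2 (w (alpha m + q) + x q - m (x w))],
    and [q = <a - m T, A T>], so that [q ^ 2 <= L ^ 2 w] where [L] bounds the
    operator norm of [A].

    Let [alpha > 0]. The region [R_+(K)] is [x >= K ^ 2], [x w <= K], [m > 0].
    There [w <= 1 / K], hence [m > 1], so that [m > 0] may be replaced by the
    closed condition [m >= 1]. For [K] large, [alpha m + q > 0] on the region
    ([region_growth]), and [(x w)' < 0] where [x w = K]
    ([region_nu_decreasing]). Each inequality defining the region therefore has
    a strictly inward derivative where it is an equality, and [nagumo] yields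
    forward invariance ([region_plus_invariant]). The time reversal
    [C (- s)], [- T (- s)] maps orbits to orbits and exchanges [R_+] and [R_-],
    which gives the backward invariance of [R_-(K)].

    For the asymptotics, let [sigma' = 1 / r]. As [r' <= 2 alpha], [r] grows at
    most linearly in [s], so [sigma] dominates a logarithm and tends to infinity
    ([sigma_cvgy]). With respect to [sigma], the derivative of [x] is at least
    [2 alpha (x - 1 - K)], so [r >= exp (alpha (sigma - sigma 0))] ([r_growth]).
    Being a unit vector with [<a, T> > 0], [T] is within [K / x] of [a / r].
    Hence [D = exp (- sigma (alpha + A)) C], whose derivative is
    [exp (- sigma (alpha + A)) (T - a / r)], satisfies
    [|D'| = O (sigma' exp (- 2 alpha sigma))], because [exp (t (alpha + A))]
    multiplies norms by [exp (alpha t)] ([enorm_expmx]). So [D] has a limit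
    [Gamma], with [|D - Gamma| = O (exp (- 2 alpha sigma))]
    ([squeeze_limit]); applying [exp (sigma (alpha + A))] gives the expansion.
    If [Gamma] vanished, [C] would be bounded, contradicting the growth of [r].
    That argument does not use the equation for [T'], so replacing
    [(alpha, A)] by [(- alpha, - A)], which turns [a] into [- a] and [R_-(K)]
    into [R_+(K)], settles the case [alpha < 0]. *)

(** * Calculus on the real line *)

Section real_calculus.
Variable R : realType.
Implicit Types f g h df : R -> R.

Lemma is_derive_continuous f (x d : R) :
  is_derive x 1 f d -> {for x, continuous f}.
Proof. by move=> [fx _]; exact/differentiable_continuous/derivable1_diffP. Qed.

Lemma is_derive_ge0_le f df (a b : R) : a <= b ->
  (forall x, a <= x <= b -> is_derive x 1 f (df x)) ->
  (forall x, a <= x <= b -> 0 <= df x) -> f a <= f b.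
Proof.
move=> ab fd df0.
have [||c /itvP cab /eqP] := @MVT_segment _ f df a b ab.
- by move=> x /itvP xab; apply: fd; rewrite !xab.
- apply: derivable_within_continuous => x xab.
  by have [] : is_derive x 1 f (df x) by apply: fd; rewrite !(itvP xab).
by rewrite subr_eq => /eqP ->; rewrite lerDr mulr_ge0 ?subr_ge0// df0 ?cab.
Qed.

Lemma is_derive_gt0_right f (x d : R) : is_derive x 1 f d -> 0 < d ->
  \forall y \near x^'+, f x < f y.
Proof.
move=> [fx <-] d0.
have : h^-1 *: ((f \o shift x) (h *: 1) - f x) @[h --> 0^'] --> 'D_1 f x by [].
move/cvgrPdist_lt => /(_ _ d0) [e /= e0 He].
exists e => //= y /= yx xy.
have := He (y - x); rewrite /ball_ /= sub0r normrN -normrN opprB => /(_ yx).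
have yx0 : 0 < y - x by rewrite subr_gt0.
rewrite gt_eqF// => /(_ isT).
rewrite [_ *: 1]mulr1 subrK ltr_distlC => /andP[+ _].
by rewrite subrr pmulr_rgt0 ?invr_gt0// subr_gt0.
Qed.

(** If every [f i] has a positive derivative whenever it vanishes while all the
    [f j] are nonnegative, then joint nonnegativity propagates forward. *)
Lemma nagumo (I : finType) (f df : I -> R -> R) (a b : R) : a <= b ->
  (forall i x, a <= x <= b -> is_derive x 1 (f i) (df i x)) ->
  (forall i x, a <= x <= b -> (forall j, 0 <= f j x) -> f i x = 0 ->
     0 < df i x) ->
  (forall i, 0 <= f i a) -> forall i, 0 <= f i b.
Proof.
move=> ab fd df0 fa.
(* [z], the last time up to which all the [f i] are nonnegative, is [b] *)
pose S := [set x | a <= x <= b /\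
  forall y, a <= y <= x -> forall i, 0 <= f i y].
have Sa : S a.
  by split=> [|y ya i]; [rewrite lexx ab|rewrite -(le_anti ya)].
have supS : has_sup S.
  by split; [exists a|exists b => x [/andP[]]].
set z := sup S.
have az : a <= z by exact: ub_le_sup supS.2 _ Sa.
have zb : z <= b by apply: ge_sup => [|x [/andP[]//]]; exists a.
have zab : a <= z <= b by rewrite az zb.
have fz i : 0 <= f i z.
  rewrite leNgt; apply/negP => fz0.
  have /cvgrPdist_lt := is_derive_continuous (fd i z zab).
  have fz0' : 0 < - f i z by rewrite oppr_gt0.
  move=> /(_ _ fz0')/nbhs_ballP [e /= e0 He].
  have [y Sy zy] := sup_adherent e0 supS.
  have yz : y <= z by exact: ub_le_sup supS.2 _ Sy.
  have := He y; rewrite /ball/= => /(_ _)/=.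
  rewrite ger0_norm ?subr_ge0// ltrBlDr -ltrBlDl => /(_ zy).
  have := Sy.2 y _ i; rewrite lexx (andP Sy.1).1 => /(_ isT) fy.
  by rewrite ltr_distlC => /andP[_]; rewrite subrr ltNge fy.
have fltz y i : a <= y <= z -> 0 <= f i y.
  move=> /andP[ay]; rewrite le_eqVlt => /orP[/eqP->//|yz].
  have zy0 : 0 < z - y by rewrite subr_gt0.
  have [x Sx] := sup_adherent zy0 supS.
  rewrite opprB addrC subrK => yx.
  by apply: Sx.2; rewrite ay ltW.
move: zb; rewrite le_eqVlt => /orP[/eqP <-//|zb].
have : \forall y \near z^'+, forall i, 0 <= f i y.
  apply: filter_forall => i.
  have [fi0|fi0] := eqVneq (f i z) 0.
    near=> y; rewrite -fi0 ltW//; near: y.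
    exact: is_derive_gt0_right (fd i z zab) (df0 i z zab fz fi0).
  have {}fi0 : 0 < f i z by rewrite lt_neqAle eq_sym fi0 fz.
  have /cvgrPdist_lt := is_derive_continuous (fd i z zab).
  move=> /(_ _ fi0) H; near=> y.
  have : `|f i z - f i y| < f i z by near: y; apply: cvg_within; exact: H.
  by rewrite ltr_distlC subrr => /andP[/ltW].
case=> e /= e0 He.
have [d [d0 de dzb]] : exists d, [/\ 0 < d, d < e & z + d <= b].
  exists (Num.min (e / 2) (b - z)); split.
  - by rewrite lt_min divr_gt0//= subr_gt0.
  - by rewrite gt_min ltr_pdivrMr// mulr_natr mulr2n ltrDl e0.
  - by rewrite -lerBrDl ge_min lexx orbT.
have Szd : S (z + d).
  split=> [|y /andP[ay yzd] i].
    by rewrite dzb andbT (le_trans az)// lerDl ltW.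
  have [yz|zy] := leP y z; first by apply: fltz; rewrite ay.
  apply: He => //=.
  by rewrite ltr0_norm ?subr_lt0// opprB ltrBlDl (le_lt_trans yzd)// ltrD2l.
have := ub_le_sup supS.2 Szd.
by rewrite -/z gerDl leNgt d0.
Unshelve. all: by end_near. Qed.

(** A quantitative Cauchy criterion: [g - h] is nondecreasing, [g + h] is
    nonincreasing, and the supremum of [g - h] lies between them. *)
Lemma squeeze_limit g h dg dh :
  (forall s : R, 0 <= s -> is_derive s 1 g (dg s)) ->
  (forall s : R, 0 <= s -> is_derive s 1 h (dh s)) ->
  (forall s : R, 0 <= s -> `|dg s| <= - dh s) ->
  (forall s : R, 0 <= s -> 0 <= h s) ->
  exists l, forall s : R, 0 <= s -> `|g s - l| <= h s.
Proof.
move=> gd hd gh h0.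
have up s t : 0 <= s -> s <= t -> g s - h s <= g t - h t.
  move=> s0 st.
  apply: (@is_derive_ge0_le (g \- h) (dg \- dh)) => // x /andP[sx _].
    have x0 := le_trans s0 sx.
    by have gx := gd _ x0; have hx := hd _ x0; exact: is_deriveB.
  by have := gh _ (le_trans s0 sx); rewrite ler_norml opprK /= => /andP[]; lra.
have dn s t : 0 <= s -> s <= t -> g t + h t <= g s + h s.
  move=> s0 st; rewrite -lerN2.
  apply: (@is_derive_ge0_le (fun x => - (g x + h x)) (fun x => - (dg x + dh x)))
    => // x /andP[sx _].
    have x0 := le_trans s0 sx.
    by have gx := gd _ x0; have hx := hd _ x0; exact: is_deriveN.
  by have := gh _ (le_trans s0 sx); rewrite ler_norml opprK /= => /andP[]; lra.
have H s t : 0 <= s -> 0 <= t -> g t - h t <= g s + h s.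
  move=> s0 t0; have [st|/ltW ts] := leP s t.
    by have := dn _ _ s0 st; have := h0 _ t0; lra.
  by have := up _ _ t0 ts; have := h0 _ s0; lra.
pose S := [set g t - h t | t in [set t | 0 <= t]].
have S0 : S !=set0 by exists (g 0 - h 0); exists 0 => //=.
exists (sup S) => s s0.
have l1 : g s - h s <= sup S.
  apply: ub_le_sup; last by exists s.
  by exists (g 0 + h 0) => _ [t /= t0 <-]; exact: H.
have l2 : sup S <= g s + h s by apply: ge_sup => // _ [t /= t0 <-]; exact: H.
by rewrite ler_norml; apply/andP; split; lra.
Qed.

End real_calculus.

(** * The Euclidean inner product *)

Section inner_product.
Variables (R : realType) (n : nat).
Implicit Types (u v w : 'cV[R]_n) (A : 'M[R]_n) (k : R).

Lemma dotvE u v : dotv u v = (u^T *m v) 0 0.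
Proof. by rewrite mxE; apply: eq_bigr => i _; rewrite mxE. Qed.

Lemma dotvC u v : dotv u v = dotv v u.
Proof. by apply: eq_bigr => i _; rewrite mulrC. Qed.

Lemma dotvDr u v w : dotv u (v + w) = dotv u v + dotv u w.
Proof. by rewrite !dotvE mulmxDr mxE. Qed.

Lemma dotvNr u v : dotv u (- v) = - dotv u v.
Proof. by rewrite !dotvE mulmxN mxE. Qed.

Lemma dotvZr k u v : dotv u (k *: v) = k * dotv u v.
Proof. by rewrite !dotvE -scalemxAr mxE. Qed.

Lemma dotvDl u v w : dotv (v + w) u = dotv v u + dotv w u.
Proof. by rewrite dotvC dotvDr !(dotvC u). Qed.

Lemma dotvNl u v : dotv (- v) u = - dotv v u.
Proof. by rewrite dotvC dotvNr (dotvC u). Qed.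

Lemma dotvZl k u v : dotv (k *: v) u = k * dotv v u.
Proof. by rewrite dotvC dotvZr (dotvC u). Qed.

(** Bilinearity of [dotv], for expanding inner products by rewriting. *)
Definition dotv_bilinE := (dotvDr, dotvNr, dotvZr, dotvDl, dotvNl, dotvZl).

Lemma dotv_ge0 u : 0 <= dotv u u.
Proof. by apply: sumr_ge0 => i _; rewrite -expr2 sqr_ge0. Qed.

Lemma sqr_coord_le u i : u i 0 ^+ 2 <= dotv u u.
Proof.
rewrite /dotv (bigD1 i)//= -expr2 lerDl.
by apply: sumr_ge0 => j _; rewrite -expr2 sqr_ge0.
Qed.

Lemma sqr_enorm u : enorm u ^+ 2 = dotv u u.
Proof. by rewrite sqr_sqrtr// dotv_ge0. Qed.

Lemma enorm_ge0 u : 0 <= enorm u.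
Proof. exact: sqrtr_ge0. Qed.

Lemma enormN u : enorm (- u) = enorm u.
Proof. by rewrite /enorm !dotv_bilinE opprK. Qed.

Lemma coord_le_enorm u i : `|u i 0| <= enorm u.
Proof. by rewrite -sqrtr_sqr ler_wsqrtr// sqr_coord_le. Qed.

Lemma cauchy_schwarz u v : dotv u v ^+ 2 <= dotv u u * dotv v v.
Proof.
have := dotv_ge0 (dotv v v *: u - dotv u v *: v).
rewrite !dotv_bilinE (dotvC v u) => H.
have := dotv_ge0 v; rewrite le_eqVlt => /orP[/eqP vv|vv].
  have v0 : dotv u v = 0.
    apply: big1 => i _.
    have /eqP : v i 0 ^+ 2 = 0.
      by apply/eqP; rewrite eq_le sqr_ge0 andbT vv sqr_coord_le.
    by rewrite sqrf_eq0 => /eqP ->; rewrite mulr0.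
  by rewrite v0 expr0n -vv mulr0.
rewrite -subr_ge0 -(pmulr_rge0 _ vv); move: H; congr (_ <= _); ring.
Qed.

Lemma enorm_le_sum u : enorm u <= \sum_i `|u i 0|.
Proof.
rewrite -(ler_pXn2r (ltn0Sn 1)) ?nnegrE ?enorm_ge0 ?sumr_ge0//.
rewrite sqr_enorm expr2 mulr_suml; apply: ler_sum => i _.
rewrite (le_trans (ler_norm _))// normrM ler_wpM2l//.
by rewrite (bigD1 i)//= lerDl sumr_ge0.
Qed.

Lemma dotv_mulmx_adj A u v : dotv u (A *m v) = dotv (A^T *m u) v.
Proof. by rewrite !dotvE trmx_mul trmxK mulmxA. Qed.

Lemma dotv_antisym A u v : A^T = - A -> dotv u (A *m v) = - dotv v (A *m u).
Proof. by move=> At; rewrite dotv_mulmx_adj At mulNmx dotvNl dotvC. Qed.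

Lemma dotv_antisym0 A u : A^T = - A -> dotv u (A *m u) = 0.
Proof. by move=> At; have := dotv_antisym u u At; lra. Qed.

(** A bound on the operator norm of [A], the Frobenius norm serving as [L]. *)
Lemma dotv_mulmx_bound A : exists L : R,
  forall u, dotv (A *m u) (A *m u) <= L ^+ 2 * dotv u u.
Proof.
have S0 : 0 <= \sum_i \sum_j A i j ^+ 2.
  by apply: sumr_ge0 => i _; apply: sumr_ge0 => j _; exact: sqr_ge0.
exists (Num.sqrt (\sum_i \sum_j A i j ^+ 2)) => u.
rewrite sqr_sqrtr// mulr_suml; apply: ler_sum => i _.
have -> : (A *m u) i 0 = dotv (\col_j A i j) u.
  by rewrite mxE; apply: eq_bigr => j _; rewrite mxE.
apply: le_trans (cauchy_schwarz _ _) _.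
by rewrite ler_wpM2r ?dotv_ge0//; apply: ler_sum => j _; rewrite !mxE.
Qed.

End inner_product.

(** * Calculus of matrix-valued functions *)

Section matrix_calculus.
Variable R : realType.

Lemma is_derive_coord m n (M : R -> 'M[R]_(m, n)) (x : R)
    (D : 'M[R]_(m, n)) i j :
  is_derive x 1 M D -> is_derive x 1 (fun t => M t i j) (D i j).
Proof.
move=> [Mx MD]; apply: DeriveDef; first exact: (derivable_mxP M x 1).1.
by rewrite -MD derive_mx// mxE.
Qed.

Lemma is_derive_coords m n (M : R -> 'M[R]_(m, n)) (x : R) (D : 'M[R]_(m, n)) :
  (forall i j, is_derive x 1 (fun t => M t i j) (D i j)) -> is_derive x 1 M D.
Proof.
move=> H; have Mx : derivable M x 1.
  by apply/derivable_mxP => i j; have [] := H i j.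
apply: DeriveDef => //; rewrite derive_mx//; apply/matrixP => i j.
by rewrite mxE; have [] := H i j.
Qed.

Lemma is_derive_mulmx m n p (M : R -> 'M[R]_(m, n)) (N : R -> 'M[R]_(n, p))
    (x : R) M' N' : is_derive x 1 M M' -> is_derive x 1 N N' ->
  is_derive x 1 (fun t => M t *m N t) (M' *m N x + M x *m N').
Proof.
move=> dM dN; apply: is_derive_coords => i j.
have -> : (fun t => (M t *m N t) i j) =
    \sum_(k < n) ((fun t => M t i k) * (fun t => N t k j)).
  by apply/funext => t; rewrite mxE fct_sumE.
have H k : is_derive x 1 ((fun t => M t i k) * (fun t => N t k j))
    (M x i k *: N' k j + N x k j *: M' i k).
  by have dMk := is_derive_coord i k dM; have dNk := is_derive_coord k j dN;
     exact: is_deriveM.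
apply: is_derive_eq; rewrite !mxE -big_split/=; apply: eq_bigr => k _.
by rewrite addrC [_ *: M' _ _]mulrC.
Qed.

Lemma is_derive_mulmxl m n p (A : 'M[R]_(m, n)) (N : R -> 'M[R]_(n, p))
    (x : R) N' : is_derive x 1 N N' ->
  is_derive x 1 (fun t => A *m N t) (A *m N').
Proof.
move=> dN; apply: is_derive_eq.
  exact: is_derive_mulmx (is_derive_cst A x 1) dN.
by rewrite mul0mx add0r.
Qed.

Lemma is_derive_trmx m n (M : R -> 'M[R]_(m, n)) (x : R) M' :
  is_derive x 1 M M' -> is_derive x 1 (fun t => (M t)^T) M'^T.
Proof.
move=> dM; apply: is_derive_coords => i j; rewrite mxE.
have -> : (fun t => (M t)^T i j) = (fun t => M t j i).
  by apply/funext => t; rewrite mxE.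
exact: is_derive_coord.
Qed.

Lemma is_derive_dotv n (u v : R -> 'cV[R]_n) (x : R) u' v' :
  is_derive x 1 u u' -> is_derive x 1 v v' ->
  is_derive x 1 (fun t => dotv (u t) (v t)) (dotv u' (v x) + dotv (u x) v').
Proof.
move=> du dv; have dut := is_derive_trmx du.
have := is_derive_coord 0 0 (is_derive_mulmx dut dv).
rewrite mxE -!dotvE; congr is_derive.
by apply/funext => t; rewrite dotvE.
Qed.

Lemma is_derive_mx_comp m n (M : R -> 'M[R]_(m, n)) (f : R -> R) (x : R) M' f' :
  is_derive (f x) 1 M M' -> is_derive x 1 f f' ->
  is_derive x 1 (fun t => M (f t)) (f' *: M').
Proof.
move=> dM df; apply: is_derive_coords => i j; rewrite mxE mulrC.
by have dMij := is_derive_coord i j dM; exact: is_derive1_comp.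
Qed.

Lemma cvg_finsum n (F : 'I_n -> nat -> R) (l : 'I_n -> R) :
  (forall i, F i k @[k --> \oo] --> l i) ->
  \sum_i F i k @[k --> \oo] --> \sum_i l i.
Proof.
move=> H; rewrite (_ : (fun k => _) = \sum_i F i).
  by elim/big_ind2 : _ => // *; [exact: cvg_cst|exact: cvgD].
by apply/funext => k; rewrite fct_sumE.
Qed.

Lemma cvg_mx_coords m n (F : nat -> 'M[R]_(m, n)) (L : 'M[R]_(m, n)) :
  (forall i j, F k i j @[k --> \oo] --> L i j) -> F @ \oo --> L.
Proof.
move=> H; apply/cvgrPdist_le => /= e e0; near=> k.
rewrite /Num.Def.normr/= mx_normrE (bigmax_le _ (ltW e0))//= => i _.
rewrite !mxE/=; move: i; near: k; apply: filter_forall => /= i.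
exact: ((cvgrPdist_le _ _).1 (H i.1 i.2)).
Unshelve. all: by end_near. Qed.

End matrix_calculus.

(** * The matrix exponential *)

Section matrix_exponential.
Variables (R : realType) (n : nat) (M : 'M[R]_n).
Implicit Types (t : R) (i j : 'I_n).

Let beta : R := \sum_i \sum_j `|M i j|.

Let beta_ge0 : 0 <= beta.
Proof. by apply: sumr_ge0 => i _; apply: sumr_ge0. Qed.

Let expr_mx_bound k i j : `|(M ^+ k) i j| <= beta ^+ k.
Proof.
elim: k i j => [|k IH] i j.
  by rewrite expr0 mxE; case: eqP => _; rewrite ?normr1 ?normr0.
rewrite exprS mxE (le_trans (ler_norm_sum _ _ _))// exprS.
have : \sum_l `|M i l| * beta ^+ k <= beta * beta ^+ k.
  rewrite -mulr_suml ler_wpM2r ?exprn_ge0//.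
  rewrite /beta [leRHS](bigD1 i)//= lerDl.
  by apply: sumr_ge0 => l _; apply: sumr_ge0.
apply: le_trans; apply: ler_sum => l _.
by rewrite normrM ler_wpM2l.
Qed.

(** Coefficients of the entry [(i, j)] of the [d]-th derivative of
    [t |-> expmx (t *: M)], a power series in [t]. *)
Definition expmx_coef d i j (k : nat) : R := (k`!%:R)^-1 * (M ^+ (k + d)) i j.

Lemma expmx_coef_diffs d i j :
  pseries_diffs (expmx_coef d i j) = expmx_coef d.+1 i j.
Proof.
apply/funext => k; rewrite /pseries_diffs /expmx_coef factS natrM invfM.
by rewrite addSnnS mulrA mulrA mulfV ?mul1r// pnatr_eq0.
Qed.

Lemma cvg_expmx_coef d i j t : cvgn (pseries (expmx_coef d i j) t).
Proof.
apply: normed_cvg => /=.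
have H : cvgn (series (beta ^+ d *: exp_coeff (beta * `|t|))).
  exact/is_cvg_seriesZ/is_cvg_series_exp_coeff.
apply: series_le_cvg H => [k|k|k] /=; first by [].
  rewrite fctE.
  by rewrite mulr_ge0 ?exprn_ge0// /exp_coeff/= divr_ge0// exprn_ge0// mulr_ge0.
rewrite /exp_coeff /expmx_coef /= !normrM normfV normr_nat normrX.
rewrite [leRHS](_ : _ = k`!%:R^-1 * beta ^+ (k + d) * `|t| ^+ k).
  by rewrite ler_wpM2r ?exprn_ge0// ler_wpM2l ?invr_ge0.
rewrite exprD fctE -[(_ *: _)]/(_ * ((beta * `|t|) ^+ k / k`!%:R)).
by rewrite exprMn; ring.
Qed.

Lemma scale_expr t k : (t *: M) ^+ k = t ^+ k *: M ^+ k.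
Proof.
elim: k => [|k IH]; first by rewrite !expr0 scale1r.
by rewrite !exprS IH -[_ * _]scalemxAl -scalemxAr scalerA.
Qed.

Lemma cvg_expmx t : series (fun k : nat => (k`!%:R)^-1 *: (t *: M) ^+ k) @ \oo
  --> \matrix_(i, j) limn (pseries (expmx_coef 0 i j) t).
Proof.
apply: cvg_mx_coords => i j; rewrite mxE.
rewrite (_ : (fun k => _) = pseries (expmx_coef 0 i j) t).
  exact: cvg_expmx_coef.
apply/funext => k; rewrite /series /pseries /= summxE; apply: eq_bigr => l _.
by rewrite scale_expr !mxE /expmx_coef addn0 -mulrA [t ^+ l * _]mulrC.
Qed.

Lemma expmxE t i j : expmx (t *: M) i j = limn (pseries (expmx_coef 0 i j) t).
Proof.
have -> : expmx (t *: M) = \matrix_(i, j) limn (pseries (expmx_coef 0 i j) t).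
  by apply/cvg_lim; [exact: norm_hausdorff|exact: cvg_expmx].
by rewrite mxE.
Qed.

(** The two ways to split [M ^+ k.+1] give the two forms of the derivative of
    [expmx (t *: M)], hence the commutation [expmx_comm]. *)
Lemma lim_expmx_coefSl t i j : limn (pseries (expmx_coef 1 i j) t) =
  (M *m expmx (t *: M)) i j.
Proof.
apply/cvg_lim; first exact: norm_hausdorff.
rewrite mxE (_ : pseries _ _ =
  (fun k => \sum_l M i l * pseries (expmx_coef 0 l j) t k)).
  apply: cvg_finsum => l; rewrite expmxE.
  by apply: cvgM; [exact: cvg_cst|exact: cvg_expmx_coef].
apply/funext => k; rewrite /pseries /series/=.
under [RHS]eq_bigr do rewrite mulr_sumr.
rewrite exchange_big/=; apply: eq_bigr => l _.
rewrite /expmx_coef addn1 addn0 exprS mxE mulr_sumr mulr_suml.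
by apply: eq_bigr => a _; ring.
Qed.

Lemma lim_expmx_coefSr t i j : limn (pseries (expmx_coef 1 i j) t) =
  (expmx (t *: M) *m M) i j.
Proof.
apply/cvg_lim; first exact: norm_hausdorff.
rewrite mxE (_ : pseries _ _ =
  (fun k => \sum_l pseries (expmx_coef 0 i l) t k * M l j)).
  apply: cvg_finsum => l; rewrite expmxE.
  by apply: cvgM; [exact: cvg_expmx_coef|exact: cvg_cst].
apply/funext => k; rewrite /pseries /series/=.
under [RHS]eq_bigr do rewrite mulr_suml.
rewrite exchange_big/=; apply: eq_bigr => l _.
rewrite /expmx_coef addn1 addn0 exprSr mxE mulr_sumr mulr_suml.
by apply: eq_bigr => a _; ring.
Qed.

Lemma expmx_comm t : M *m expmx (t *: M) = expmx (t *: M) *m M.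
Proof. by apply/matrixP => i j; rewrite -lim_expmx_coefSl lim_expmx_coefSr. Qed.

Lemma is_derive_expmx t :
  is_derive t 1 (fun x => expmx (x *: M)) (M *m expmx (t *: M)).
Proof.
apply: is_derive_coords => i j; rewrite -lim_expmx_coefSl.
rewrite (_ : (fun x => _) = (fun x => limn (pseries (expmx_coef 0 i j) x))).
  rewrite -expmx_coef_diffs.
  apply: (@pseries_snd_diffs _ _ (`|t| + 1)); rewrite ?expmx_coef_diffs;
    try exact: cvg_expmx_coef.
  by rewrite [ltRHS]ger0_norm ?addr_ge0// ltrDl.
by apply/funext => x; rewrite expmxE.
Qed.

Lemma expmx0 : expmx (0 *: M) = 1%:M.
Proof.
apply/matrixP => i j; rewrite expmxE.
apply/cvg_lim; first exact: norm_hausdorff.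
rewrite -cvg_shiftS/=; apply: cvg_near_cst; near=> k.
rewrite /pseries /series /= big_nat_recl//= big1 ?addr0 => [|l _].
  by rewrite /expmx_coef expr0 fact0 invr1 !mul1r mulr1 expr0.
by rewrite expr0n mulr0.
Unshelve. all: by end_near. Qed.

Lemma expmxNK t : expmx (t *: M) *m expmx (- t *: M) = 1%:M.
Proof.
apply/matrixP => i j; pose f x := (expmx (x *: M) *m expmx (- x *: M)) i j.
suff : f t = f 0 by rewrite /f oppr0 !expmx0 mul1mx.
apply: is_derive_0_is_cst => x.
have dN : is_derive x 1 (fun x => expmx (- x *: M))
    (-1 *: (M *m expmx (- x *: M))).
  apply: (is_derive_mx_comp (M := fun y => expmx (y *: M)) (f := -%R)).
  exact: is_derive_expmx.
have := is_derive_coord i j (is_derive_mulmx (is_derive_expmx x) dN).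
congr is_derive; rewrite scaleN1r mulmxN expmx_comm mulmxA subrr.
by rewrite mxE.
Qed.

End matrix_exponential.

Lemma dotv_expmx (R : realType) n (alpha : R) (A : 'M[R]_n) (v : 'cV[R]_n) t :
  A^T = - A -> let E := expmx (t *: (alpha%:M + A)) in
  dotv (E *m v) (E *m v) = expR (2 * alpha * t) * dotv v v.
Proof.
move=> At /=; set B := _ + A.
(* [g] has zero derivative, as [<y, (alpha + A) y> = alpha <y, y>] *)
pose g x := expR (- (2 * alpha) * x) *
  dotv (expmx (x *: B) *m v) (expmx (x *: B) *m v).
suff : g t = g 0.
  rewrite /g expmx0 mul1mx mulr0 expR0 mul1r => <-.
  by rewrite mulrA -expRD mulNr subrr expR0 mul1r.
apply: is_derive_0_is_cst => x.
have dE : is_derive x 1 (fun x => expmx (x *: B) *m v)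
    (B *m (expmx (x *: B) *m v)).
  apply: is_derive_eq.
    exact: is_derive_mulmx (is_derive_expmx B x) (is_derive_cst v x 1).
  by rewrite mulmx0 addr0 mulmxA.
have dd := is_derive_dotv dE dE.
have de : is_derive x 1 (fun x => expR (- (2 * alpha) * x))
    (expR (- (2 * alpha) * x) * (- (2 * alpha))).
  apply: (is_derive1_comp (f := expR) (g := fun y => _ * y)).
  have := is_deriveZ (- (2 * alpha)) (is_derive_id x (1 : R)).
  by rewrite [_ *: 1]mulr1.
have := is_deriveM de dd; congr is_derive.
set y := expmx _ *m v.
rewrite (dotvC (B *m y)).
have -> : dotv y (B *m y) = alpha * dotv y y.
  by rewrite mulmxDl mul_scalar_mx !dotv_bilinE dotv_antisym0// addr0.
by rewrite /GRing.scale/=; ring.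
Qed.

(** [exp (t A)] is an isometry, so only the scalar [alpha] affects norms. *)
Lemma enorm_expmx (R : realType) n (alpha : R) (A : 'M[R]_n) (v : 'cV[R]_n) t :
  A^T = - A ->
  enorm (expmx (t *: (alpha%:M + A)) *m v) = expR (alpha * t) * enorm v.
Proof.
move=> At; rewrite /enorm dotv_expmx// sqrtrM ?expR_ge0//.
rewrite (_ : expR _ = expR (alpha * t) ^+ 2) ?sqrtr_sqr ?ger0_norm ?expR_ge0//.
by rewrite expr2 -expRD; congr expR; ring.
Qed.

(** * Inequalities in the region *)

Section admissible.
Variable R : realType.
Implicit Types (alpha L K x m w q : R).

(** What it means for [K] to be sufficiently large, given that [L] bounds the
    operator norm of [A]. *)
Definition admissible alpha L K :=
  [/\ 2 <= K, 2 * alpha <= K, 64 * L ^+ 2 <= K & L ^+ 2 <= alpha ^+ 2 * K].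

Lemma admissible_large alpha L : alpha != 0 ->
  exists K0, forall K, K0 <= K -> admissible alpha L K.
Proof.
move=> a0; have a2 : 0 < alpha ^+ 2 by rewrite exprn_even_gt0.
exists (2 + 2 * `|alpha| + 64 * L ^+ 2 + L ^+ 2 / alpha ^+ 2) => K.
have := ler_norm alpha; have := normr_ge0 alpha; have := sqr_ge0 L.
have := divr_ge0 (sqr_ge0 L) (ltW a2).
set y := _ / _ => y0 L0 al al' HK; split; try lra.
by rewrite -ler_pdivrMl// mulrC -/y; lra.
Qed.

(** The inequalities that hold in the region [R_+(K)] between [x = |a| ^ 2],
    [m = <a, T>], [w = x - m ^ 2] and [q = <a, A T>]. *)
Definition in_region L K x m w q :=
  [/\ K ^+ 2 <= x, x = m ^+ 2 + w, 0 <= w, x * w <= K &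
      0 < m /\ q ^+ 2 <= L ^+ 2 * w].

Lemma region_w_le alpha L K x m w q :
  admissible alpha L K -> in_region L K x m w q -> K * w <= 1.
Proof.
move=> [K2 _ _ _] [xK _ w0 xw _].
rewrite -(ler_pM2l (_ : 0 < K)) ?mulr1; last by lra.
by apply: le_trans xw; rewrite mulrA -expr2 ler_wpM2r.
Qed.

Lemma region_w_le_half alpha L K x m w q :
  admissible alpha L K -> in_region L K x m w q -> w <= 1 / 2.
Proof.
move=> adm reg; have := region_w_le adm reg.
case: adm reg => K2 _ _ _ [_ _ w0 _ _]; nra.
Qed.

Lemma region_m_gt1 alpha L K x m w q :
  admissible alpha L K -> in_region L K x m w q -> 1 < m.
Proof.
move=> adm reg; have wh := region_w_le_half adm reg.
case: adm reg => K2 _ _ _ [xK xE _ _ [m0 _]].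
have K4 : 4 <= K ^+ 2 by nra.
rewrite ltNge; apply/negP => m1.
have m2 : m ^+ 2 <= 1 by rewrite expr_le1// ltW.
suff : K ^+ 2 < K ^+ 2 by rewrite ltxx.
lra.
Qed.

Lemma region_q_le alpha L K x m w q : 0 < alpha ->
  admissible alpha L K -> in_region L K x m w q -> `|q| <= alpha.
Proof.
move=> alpha0 adm reg; have wK := region_w_le adm reg.
case: adm reg => K2 _ _ LK [_ _ w0 _ [_ qw]].
rewrite -(ler_pXn2r (ltn0Sn 1)) ?nnegrE ?(ltW alpha0)//.
rewrite real_normK ?num_real// -(ler_pM2l (_ : 0 < K)); last by lra.
have H : K * q ^+ 2 <= K * (L ^+ 2 * w) by rewrite ler_wpM2l//; lra.
have H2 : L ^+ 2 * (K * w) <= L ^+ 2 * 1 by rewrite ler_wpM2l ?sqr_ge0.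
by lra.
Qed.

(** [x = |a| ^ 2], whose derivative is [2 * (alpha * m + q)], increases. *)
Lemma region_growth alpha L K x m w q : 0 < alpha ->
  admissible alpha L K -> in_region L K x m w q -> 0 < alpha * m + q.
Proof.
move=> alpha0 adm reg; have := region_q_le alpha0 adm reg.
have := region_m_gt1 adm reg; rewrite ler_norml => m1 /andP[+ _].
nra.
Qed.

(** The left-hand side is half the derivative of [nu = x * w] where [nu = K]. *)
Lemma region_nu_decreasing alpha L K x m w q : 0 < alpha ->
  admissible alpha L K -> in_region L K x m w q -> x * w = K ->
  w * (alpha * m + q) + x * q - m * K < 0.
Proof.
move=> alpha0 adm reg xwK.
have := region_q_le alpha0 adm reg; rewrite ler_norml => /andP[_ qa].
have m1 := region_m_gt1 adm reg.
have wK := region_w_le adm reg; have wh := region_w_le_half adm reg.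
case: adm reg => K2 aK LK _ [xK xE w0 _ [m0 qw]].
have H1 : w * (alpha * m + q) <= m.
  have Hq : w * (alpha * m + q) <= w * (2 * alpha * m).
    by rewrite ler_wpM2l//; nra.
  have Ha : 2 * alpha * w <= K * w by rewrite ler_wpM2r.
  have Hm : 2 * alpha * w * m <= 1 * m by rewrite ler_wpM2r//; lra.
  lra.
have H2 : x * q <= K * m / 4.
  apply: le_trans (ler_norm _) _.
  rewrite -(ler_pXn2r (ltn0Sn 1)) ?nnegrE//; last first.
    by rewrite divr_ge0// mulr_ge0//; lra.
  rewrite real_normK ?num_real// exprMn.
  have Hq : x ^+ 2 * q ^+ 2 <= x ^+ 2 * (L ^+ 2 * w).
    by rewrite ler_wpM2l ?sqr_ge0.
  have E1 : x ^+ 2 * (L ^+ 2 * w) = L ^+ 2 * x * K by rewrite -xwK; ring.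
  have x2 : x <= 2 * m ^+ 2 by rewrite xE; nra.
  have Hx : L ^+ 2 * x * K <= L ^+ 2 * (2 * m ^+ 2) * K.
    by rewrite ler_wpM2r ?ler_wpM2l ?sqr_ge0//; lra.
  have mK0 : 0 <= m ^+ 2 * K by rewrite mulr_ge0 ?sqr_ge0//; lra.
  have HL : 64 * L ^+ 2 * (m ^+ 2 * K) <= K * (m ^+ 2 * K) by rewrite ler_wpM2r.
  have KmK0 : 0 <= K * (m ^+ 2 * K) by rewrite mulr_ge0//; lra.
  have -> : (K * m / 4) ^+ 2 = K * (m ^+ 2 * K) / 16 by field.
  lra.
have : 2 * m <= K * m by rewrite ler_wpM2r// ltW.
lra.
Qed.

(** Since [d / d sigma = r * d / ds], the right-hand side is the derivative of
    [x] with respect to [sigma]. *)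
Lemma region_growth_sigma alpha L K x m w q r : 0 < alpha ->
  admissible alpha L K -> in_region L K x m w q -> 0 <= r -> r ^+ 2 = x ->
  2 * alpha * (x - 1 - K) <= r * (2 * (alpha * m + q)).
Proof.
move=> alpha0 adm reg r0 rx; have wh := region_w_le_half adm reg.
case: adm reg => K2 _ _ LK [xK xE w0 xw [m0 qw]].
have mr : m <= r.
  by rewrite -(ler_pXn2r (ltn0Sn 1)) ?nnegrE ?(ltW m0)// rx xE lerDl.
have mm : m * m <= r * m by rewrite ler_wpM2r// ltW.
have H1 : x - 1 <= r * m by rewrite xE; lra.
have H2 : `|r * q| <= alpha * K.
  rewrite -(ler_pXn2r (ltn0Sn 1)) ?nnegrE//; last by rewrite mulr_ge0//; lra.
  rewrite real_normK ?num_real// exprMn rx.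
  have x0 : 0 <= x by rewrite -rx sqr_ge0.
  have Hq : x * q ^+ 2 <= x * (L ^+ 2 * w) by rewrite ler_wpM2l.
  have Hw : L ^+ 2 * (x * w) <= L ^+ 2 * K by rewrite ler_wpM2l ?sqr_ge0.
  have HK : L ^+ 2 * K <= alpha ^+ 2 * K * K by rewrite ler_wpM2r//; lra.
  by rewrite exprMn; lra.
move: H2; rewrite ler_norml => /andP[H2 _].
have : alpha * (x - 1) <= alpha * (r * m) by rewrite ler_wpM2l// ltW.
lra.
Qed.

End admissible.

(** * The soliton flow *)

Section soliton.
Variables (R : realType) (n : nat) (A : 'M[R]_n) (alpha : R).
Hypothesis A_antisym : A^T = - A.
Implicit Types (c t : 'cV[R]_n) (C T : R -> 'cV[R]_n).

Local Notation a := (avec alpha A).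
Local Notation sqa c := (dotv (a c) (a c)).

Lemma avecE c : a c = alpha *: c + A *m c.
Proof. by rewrite /avec mulmxDl mul_scalar_mx. Qed.

Lemma avec_orth_ge0 c t : enorm t = 1 -> 0 <= sqa c - dotv (a c) t ^+ 2.
Proof.
move=> t1; have tt : dotv t t = 1 by rewrite -sqr_enorm t1 expr1n.
by have := cauchy_schwarz (a c) t; rewrite tt mulr1 subr_ge0.
Qed.

(** Antisymmetry gives [<a, A t> = <a - <a, t> t, A t>], whence the bound by the
    part of [a] orthogonal to [t] only. *)
Lemma avec_q_bound L c t :
  (forall u, dotv (A *m u) (A *m u) <= L ^+ 2 * dotv u u) -> enorm t = 1 ->
  dotv (a c) (A *m t) ^+ 2 <= L ^+ 2 * (sqa c - dotv (a c) t ^+ 2).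
Proof.
move=> AL t1; have tt : dotv t t = 1 by rewrite -sqr_enorm t1 expr1n.
set b := a c; pose m := dotv b t.
have -> : dotv b (A *m t) = dotv (b - m *: t) (A *m t).
  by rewrite !dotv_bilinE dotv_antisym0// mulr0 oppr0 addr0.
apply: le_trans (cauchy_schwarz _ _) _; rewrite mulrC.
have -> : dotv (b - m *: t) (b - m *: t) = dotv b b - m ^+ 2.
  by rewrite !dotv_bilinE tt (dotvC t b) -/m; ring.
rewrite ler_wpM2r ?avec_orth_ge0//.
by have := AL t; rewrite tt mulr1.
Qed.

Lemma muE c t : mu alpha A c t = dotv (a c) t / enorm (a c).
Proof. by rewrite /mu /ahat dotvZl mulrC. Qed.

Lemma nuE c t : enorm (a c) != 0 ->
  nu alpha A c t = sqa c * (sqa c - dotv (a c) t ^+ 2).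
Proof. by move=> a0; rewrite /nu muE -sqr_enorm; field. Qed.

Lemma region_plusP K c t : 0 < K -> region_plus alpha A K (c, t) <->
  [/\ enorm t = 1, K ^+ 2 <= sqa c,
      sqa c * (sqa c - dotv (a c) t ^+ 2) <= K & 0 < dotv (a c) t].
Proof.
move=> K0; have KE : (K <= enorm (a c)) = (K ^+ 2 <= sqa c).
  by rewrite -sqr_enorm ler_pXn2r ?nnegrE ?enorm_ge0// ltW.
rewrite /region_plus/=; split=> [[t1 Ka nuK m0]|[t1 Ka nuK m0]].
  have r0 : 0 < enorm (a c) by exact: lt_le_trans Ka.
  split=> //; rewrite -?KE// -?nuE ?gt_eqF//.
  by move: m0; rewrite muE pmulr_lgt0// invr_gt0.
have r0 : 0 < enorm (a c) by rewrite (lt_le_trans K0)// KE.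
by split=> //; rewrite ?KE// ?nuE ?gt_eqF// muE pmulr_lgt0// invr_gt0.
Qed.

Lemma region_minusN K c t :
  region_minus alpha A K (c, t) <-> region_plus alpha A K (c, - t).
Proof.
have mN : mu alpha A c (- t) = - mu alpha A c t by rewrite /mu dotvNr.
by rewrite /region_minus /region_plus/= enormN /nu mN sqrrN oppr_gt0.
Qed.

Section derivatives.
Variables (C T : R -> 'cV[R]_n) (s : R).
Hypotheses (T1 : enorm (T s) = 1) (dC : is_derive s 1 C (T s)).

Lemma is_derive_avec : is_derive s 1 (fun x => a (C x)) (a (T s)).
Proof. exact: is_derive_mulmxl. Qed.

Lemma is_derive_sqa : is_derive s 1 (fun x => sqa (C x))
  (2 * (alpha * dotv (a (C s)) (T s) + dotv (a (C s)) (A *m T s))).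
Proof.
apply: is_derive_eq; first exact: is_derive_dotv is_derive_avec is_derive_avec.
by rewrite (dotvC (a (T s))) (avecE (T s)) !dotv_bilinE; ring.
Qed.

Lemma is_derive_avec_T :
  is_derive s 1 T (proj_orth (T s) (a (C s))) ->
  is_derive s 1 (fun x => dotv (a (C x)) (T x))
    (alpha + (sqa (C s) - dotv (a (C s)) (T s) ^+ 2)).
Proof.
have tt : dotv (T s) (T s) = 1 by rewrite -sqr_enorm T1 expr1n.
move=> dT; apply: is_derive_eq; first exact: is_derive_dotv is_derive_avec dT.
rewrite (avecE (T s)) /proj_orth T1 expr1n divr1 !dotv_bilinE tt.
by rewrite (dotvC _ (T s)) dotv_antisym0//; ring.
Qed.

End derivatives.

Variable L : R.
Hypotheses (L_bound : forall u, dotv (A *m u) (A *m u) <= L ^+ 2 * dotv u u).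
Hypothesis alpha_gt0 : 0 < alpha.

Variable K : R.
Hypothesis K_adm : admissible alpha L K.

Let K_gt0 : 0 < K. Proof. by have [] := K_adm; lra. Qed.

Lemma region_plus_invariant C T s0 s1 : s0 <= s1 ->
  (forall s, s0 <= s <= s1 -> [/\ enorm (T s) = 1, is_derive s 1 C (T s) &
     is_derive s 1 T (proj_orth (T s) (a (C s)))]) ->
  region_plus alpha A K (C s0, T s0) -> region_plus alpha A K (C s1, T s1).
Proof.
move=> s01 orb /(region_plusP _ _ K_gt0)[_ Kx nuK m0].
pose x s := sqa (C s); pose m s := dotv (a (C s)) (T s).
pose w s := x s - m s ^+ 2; pose q s := dotv (a (C s)) (A *m T s).
have dx s : s0 <= s <= s1 -> is_derive s 1 x (2 * (alpha * m s + q s)).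
  by move=> /orb[T1 dC dT]; exact: is_derive_sqa.
have dm s : s0 <= s <= s1 -> is_derive s 1 m (alpha + w s).
  by move=> /orb[T1 dC dT]; exact: is_derive_avec_T.
have dnu s : s0 <= s <= s1 -> is_derive s 1 (fun s => x s * w s)
    (2 * (w s * (alpha * m s + q s) + x s * q s - m s * (x s * w s))).
  move=> ss; have dxs := dx s ss; have dms := dm s ss.
  have := is_deriveM dxs (is_deriveB dxs (is_deriveM dms dms)).
  congr is_derive; rewrite /w /GRing.scale/=.
  by rewrite !fctE; ring.
have reg s : s0 <= s <= s1 -> K ^+ 2 <= x s -> x s * w s <= K -> 0 < m s ->
    in_region L K (x s) (m s) (w s) (q s).
  move=> /orb[T1 _ _] Kxs xw ms0; split=> //; first by rewrite /w; ring.
    exact: avec_orth_ge0.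
  by split=> //; exact: avec_q_bound.
(* [m - 1] replaces [m], since [m >= 0] is weaker than [m > 0]; the region
   forces [m > 1] anyway *)
pose f (i : option bool) s := match i with
  | None => x s - K ^+ 2
  | Some true => K - x s * w s
  | Some false => m s - 1 end.
pose df (i : option bool) s := match i with
  | None => 2 * (alpha * m s + q s)
  | Some true =>
    - (2 * (w s * (alpha * m s + q s) + x s * q s - m s * (x s * w s)))
  | Some false => alpha + w s end.
have s00 : s0 <= s0 <= s1 by rewrite lexx s01.
have s11 : s0 <= s1 <= s1 by rewrite lexx s01.
suff H i : 0 <= f i s1.
  apply/(region_plusP _ _ K_gt0); split; first by have [] := orb _ s11.
  - by have := H None; rewrite subr_ge0.
  - by have := H (Some true); rewrite subr_ge0.
  - by have := H (Some false); rewrite subr_ge0; exact: lt_le_trans.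
apply: (nagumo s01 (df := df)) => {i} [i s ss|i s ss fs fi|i].
- have dxs := dx s ss; have dms := dm s ss; have dnus := dnu s ss.
  case: i => [[]|]; rewrite /f /df.
  + by have := is_deriveB (is_derive_cst K s (1 : R)) dnus; rewrite sub0r.
  + by have := is_deriveB dms (is_derive_cst (1 : R) s (1 : R)); rewrite subr0.
  + by have := is_deriveB dxs (is_derive_cst (K ^+ 2) s (1 : R)); rewrite subr0.
- have := fs None; have := fs (Some true); have := fs (Some false).
  rewrite /f !subr_ge0 => ms xw Kxs.
  have {}reg := reg s ss Kxs xw (lt_le_trans ltr01 ms).
  have [_ _ w0 _ _] := reg; have al0 := alpha_gt0.
  case: i fi => [[]|] /eqP; rewrite /f /df subr_eq0 => /eqP E.
  + have := region_nu_decreasing alpha_gt0 K_adm reg (esym E).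
    by rewrite -E; lra.
  + by rewrite ltr_wpDr.
  + by rewrite mulr_gt0// (region_growth alpha_gt0 K_adm reg).
- case: i => [[]|]; rewrite /f subr_ge0//.
  exact: ltW (region_m_gt1 K_adm (reg s0 s00 Kx nuK m0)).
Qed.

Section asymptotics.
Variables (C T : R -> 'cV[R]_n) (sigma : R -> R).
Hypothesis dC : forall s : R, 0 <= s -> is_derive s 1 C (T s).
Hypothesis CT_region : forall s : R, 0 <= s -> region_plus alpha A K (C s, T s).
Hypothesis dsigma : sigma_param alpha A C sigma.

Let x s := sqa (C s).
Let r s := enorm (a (C s)).
Let m s := dotv (a (C s)) (T s).
Let w s := x s - m s ^+ 2.
Let q s := dotv (a (C s)) (A *m T s).

Let reg (s : R) : 0 <= s -> in_region L K (x s) (m s) (w s) (q s).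
Proof.
move=> s0; have [T1 ? ? ?] := (region_plusP _ _ K_gt0).1 (CT_region s0).
split=> //; first by rewrite /w; ring.
  exact: avec_orth_ge0.
by split=> //; exact: avec_q_bound.
Qed.

Let rE s : r s ^+ 2 = x s. Proof. exact: sqr_enorm. Qed.

Let r_ge0 s : 0 <= r s. Proof. exact: enorm_ge0. Qed.

Let m_le_r (s : R) : 0 <= s -> m s <= r s.
Proof.
move=> s0; have [_ xE w0 _ [m0 _]] := reg s0.
by rewrite -(ler_pXn2r (ltn0Sn 1)) ?nnegrE ?(ltW m0)// rE xE lerDl.
Qed.

Let r_gt1 (s : R) : 0 <= s -> 1 < r s.
Proof.
by move=> s0; exact: lt_le_trans (region_m_gt1 K_adm (reg s0)) (m_le_r s0).
Qed.

Let dx (s : R) : 0 <= s -> is_derive s 1 x (2 * (alpha * m s + q s)).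
Proof. by move=> s0; have dCs := dC s0; exact: is_derive_sqa. Qed.

(** [r' = (alpha * m + q) / r <= 2 * alpha], as [m <= r], [q <= alpha] and
    [1 <= r]. *)
Let r_le (s : R) : 0 <= s -> r s <= r 0 + 2 * alpha * s.
Proof.
move=> s0.
pose dr y := 2 * alpha - (2 * r y)^-1 * (2 * (alpha * m y + q y)).
have : 2 * alpha * 0 - r 0 <= 2 * alpha * s - r s.
  apply: (@is_derive_ge0_le _ (fun y => 2 * alpha * y - r y) dr _ _ s0)
    => y /andP[y0 _].
    have x0 : 0 < x y by rewrite -rE exprn_gt0// (lt_trans ltr01) ?r_gt1.
    have dxy := dx y0; have dq := is_derive1_sqrt x0.
    have := is_deriveB (is_deriveZ (2 * alpha) (is_derive_id y (1 : R)))
       (is_derive1_comp (f := Num.sqrt) dq dxy).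
    by rewrite [_ *: 1]mulr1.
  have al0 := alpha_gt0; have := region_q_le alpha_gt0 K_adm (reg y0).
  rewrite ler_norml => /andP[_ qa]; have mr := m_le_r y0; have r1 := r_gt1 y0.
  have ry0 : 0 < r y by lra.
  rewrite /dr subr_ge0 mulrC ler_pdivrMr ?mulr_gt0//.
  have : alpha * m y <= alpha * r y by rewrite ler_wpM2l// ltW.
  have : alpha * 1 <= alpha * r y by rewrite ler_wpM2l// ltW.
  lra.
lra.
Qed.

(** [r] grows at most linearly, so [2 * alpha * sigma] minus a logarithm of an
    affine function is nondecreasing. *)
Lemma sigma_cvgy : sigma s @[s --> +oo] --> +oo.
Proof.
have r0 : 0 < r 0 by have := r_gt1 (lexx 0); lra.
have al2 : 0 < 2 * alpha by rewrite mulr_gt0.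
pose g s := 2 * alpha * sigma s - ln (r 0 + 2 * alpha * s).
have gle s : 0 <= s -> g 0 <= g s.
  move=> s0.
  apply: (@is_derive_ge0_le _ g (fun y => 2 * alpha * (r y)^-1
      - (r 0 + 2 * alpha * y)^-1 * (2 * alpha)) _ _ s0) => y /andP[y0 _].
    have pos : 0 < r 0 + 2 * alpha * y by rewrite ltr_wpDr// mulr_ge0// ltW.
    have ds := dsigma y0; have dl := is_derive1_ln pos.
    have dlin : is_derive y 1 (fun y => r 0 + 2 * alpha * y) (2 * alpha).
      have := is_deriveD (is_derive_cst (r 0) y (1 : R))
        (is_deriveZ (2 * alpha) (is_derive_id y (1 : R))).
      by rewrite [_ *: 1]mulr1 add0r.
    by have := is_deriveB (is_deriveZ (2 * alpha) ds)
      (is_derive1_comp (f := @ln R) (g := fun y => r 0 + 2 * alpha * y)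
        dl dlin).
  rewrite subr_ge0 mulrC ler_pM2l// lef_pV2 ?posrE.
  - exact: r_le.
  - by rewrite ltr_wpDr// mulr_ge0// ltW.
  - by have := r_gt1 y0; lra.
apply/cvgryPge => B; near=> s.
have s0 : 0 <= s by near: s; exact: nbhs_pinfty_ge.
have pos : 0 < r 0 + 2 * alpha * s by rewrite ltr_wpDr// mulr_ge0// ltW.
rewrite -(ler_pM2l al2).
have := gle s s0; rewrite /g => gs.
suff : 2 * alpha * B - g 0 <= ln (r 0 + 2 * alpha * s) by rewrite /g; lra.
rewrite -[leLHS]expRK ler_ln ?posrE ?expR_gt0//.
have : expR (2 * alpha * B - g 0) / (2 * alpha) <= s.
  by near: s; apply: nbhs_pinfty_ge; rewrite num_real.
rewrite ler_pdivrMr// => H; lra.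
Unshelve. all: by end_near. Qed.

(** The function [(x - 1 - K) * expR (- 2 * alpha * sigma)] is nondecreasing,
    and [x - 1 - K >= 1] at time [0] because [x >= K ^ 2]. *)
Lemma r_growth s : 0 <= s -> expR (alpha * (sigma s - sigma 0)) <= r s.
Proof.
move=> s0; have [K2 _ _ _] := K_adm.
pose e s := expR (- (2 * alpha) * sigma s).
have de (y : R) : 0 <= y -> is_derive y 1 e (e y * (- (2 * alpha) * (r y)^-1)).
  move=> y0; have ds := dsigma y0.
  by have := is_deriveZ (- (2 * alpha)) ds; exact: is_derive1_comp.
have mono : (x 0 - (1 + K)) * e 0 <= (x s - (1 + K)) * e s.
  apply: (@is_derive_ge0_le _ (fun y => (x y - (1 + K)) * e y) (fun y =>
    e y * ((r y)^-1 *
      (r y * (2 * (alpha * m y + q y)) - 2 * alpha * (x y - 1 - K)))) _ _ s0)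
    => y /andP[y0 _].
    have dxy := dx y0; have dey := de y y0.
    have := is_deriveM (is_deriveB dxy (is_derive_cst (1 + K) y (1 : R))) dey.
    congr is_derive; rewrite /GRing.scale/= !fctE subr0.
    by field; rewrite gt_eqF//; have := r_gt1 y0; lra.
  rewrite mulr_ge0 ?expR_ge0// mulr_ge0 ?invr_ge0// subr_ge0.
  exact: region_growth_sigma alpha_gt0 K_adm (reg y0) (r_ge0 y) (rE y).
have x0 : 1 <= x 0 - (1 + K).
  by have [Kx _ _ _ _] := reg (lexx 0); nra.
rewrite -(ler_pXn2r (ltn0Sn 1)) ?nnegrE ?expR_ge0// rE.
have -> : expR (alpha * (sigma s - sigma 0)) ^+ 2 = e 0 / e s.
  by rewrite expr2 -expRD /e -expRN -expRD; congr expR; ring.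
rewrite ler_pdivrMr ?expR_gt0//.
have e0 := expR_gt0 (- (2 * alpha) * sigma 0).
have es := expR_gt0 (- (2 * alpha) * sigma s).
have : 1 * e 0 <= (x 0 - (1 + K)) * e 0 by rewrite ler_wpM2r// ltW.
by rewrite -/(e 0) -/(e s) in e0 es; move=> ?; nra.
Qed.

(** As [0 <= m / r <= 1], the square [2 * (1 - m / r)] of the left-hand side is
    at most [2 * (1 - (m / r) ^+ 2) = 2 * w / x]. *)
Let T_close (s : R) : 0 <= s -> enorm (T s - (r s)^-1 *: a (C s)) <= K / x s.
Proof.
move=> s0; have [K2 _ _ _] := K_adm.
have [Kx xE w0 xw [m0 qw]] := reg s0.
have [T1 _ _ _] := (region_plusP _ _ K_gt0).1 (CT_region s0).
have tt : dotv (T s) (T s) = 1 by rewrite -sqr_enorm T1 expr1n.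
have x0 : 0 < x s by rewrite (lt_le_trans _ Kx)// exprn_gt0.
rewrite -(ler_pXn2r (ltn0Sn 1)) ?nnegrE ?enorm_ge0//; last first.
  by rewrite divr_ge0 ?(ltW K_gt0) ?(ltW x0).
rewrite sqr_enorm !dotv_bilinE tt (dotvC (T s)) -/(m s) -/(x s) -rE.
have r1 := r_gt1 s0; have mr := m_le_r s0.
have rn0 : r s != 0 by rewrite gt_eqF//; lra.
rewrite [leLHS](_ : _ = 2 * (r s - m s) / r s); last by field.
rewrite [leRHS](_ : _ = (K ^+ 2 / r s ^+ 3) / r s); last by field.
rewrite ler_pM2r ?invr_gt0; last by lra.
have r3 : 0 < r s ^+ 3 by rewrite exprn_gt0//; lra.
rewrite ler_pdivlMr//.
have E : w s = (r s - m s) * (r s + m s) by rewrite /w -rE; ring.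
have H : (r s - m s) * r s <= w s by rewrite E ler_wpM2l//; lra.
have : r s ^+ 2 * ((r s - m s) * r s) <= r s ^+ 2 * w s.
  by rewrite ler_wpM2l ?sqr_ge0.
rewrite rE => H2; have : 2 * (x s * w s) <= K ^+ 2 by nra.
by move: H2; rewrite -rE => *; lra.
Qed.

Lemma soliton_asymptotics : exists2 Gamma : 'cV[R]_n, Gamma != 0 &
  exists M : R, forall s, 0 <= s ->
    enorm (C s - expmx (sigma s *: (alpha%:M + A)) *m Gamma)
      <= M * expR (- alpha * sigma s).
Proof.
set B := _ + A; pose E (y : R) := expmx (y *: B).
pose D s := E (- sigma s) *m C s.
pose dD s := E (- sigma s) *m (T s - (r s)^-1 *: a (C s)).
have dDE (s : R) : 0 <= s -> is_derive s 1 D (dD s).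
  move=> s0; have ds := dsigma s0; have dCs := dC s0.
  have dN : is_derive s 1 (fun y => - sigma y) (- (r s)^-1).
    exact: is_deriveN.
  have dE := is_derive_mx_comp (M := E) (f := fun y => - sigma y)
    (is_derive_expmx B (- sigma s)) dN.
  have := is_derive_mulmx dE dCs; congr is_derive.
  rewrite expmx_comm /dD mulmxBr -scalemxAl scaleNr addrC; congr (_ - _).
  by rewrite -scalemxAr /avec mulmxA.
(* [- h] is an antiderivative of the bound on the entries of [dD] *)
pose c2 := K * expR (alpha * sigma 0) / (2 * alpha).
have c2_ge0 : 0 <= c2.
  by rewrite divr_ge0 ?mulr_ge0 ?expR_ge0 ?(ltW K_gt0) ?(ltW alpha_gt0).
pose h s := c2 * expR (- (2 * alpha) * sigma s).
pose dh s := c2 * (expR (- (2 * alpha) * sigma s) * (- (2 * alpha) * (r s)^-1)).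
have dhE (s : R) : 0 <= s -> is_derive s 1 h (dh s).
  move=> s0; have ds := dsigma s0; have dz := is_deriveZ (- (2 * alpha)) ds.
  have de := is_derive1_comp (f := expR) (g := fun y => - (2 * alpha) * sigma y)
    (is_derive_expR _) dz.
  by have := is_deriveZ c2 de.
have dDh s i : 0 <= s -> `|dD s i 0| <= - dh s.
  move=> s0; apply: le_trans (coord_le_enorm _ _) _.
  rewrite /dD /E enorm_expmx//.
  have r1 := r_gt1 s0; have rn0 : r s != 0 by rewrite gt_eqF//; lra.
  have -> : - dh s = expR (alpha * - sigma s) *
      (K * expR (- (alpha * (sigma s - sigma 0))) / r s).
    rewrite /dh /c2 (_ : - (2 * alpha) * sigma s =
      (alpha * - sigma s) +
      (- (alpha * (sigma s - sigma 0)) - alpha * sigma 0));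
      last by ring.
    rewrite !expRD (expRN (alpha * sigma 0)).
    by field; rewrite rn0 !gt_eqF// expR_gt0.
  rewrite ler_wpM2l ?expR_ge0//; apply: le_trans (T_close s0) _.
  rewrite -rE expr2 invfM mulrA ler_wpM2r ?invr_ge0// ler_wpM2l ?(ltW K_gt0)//.
  by rewrite expRN lef_pV2 ?posrE ?expR_gt0 ?r_growth//; lra.
have h_ge0 s : 0 <= s -> 0 <= h s by move=> _; rewrite mulr_ge0 ?expR_ge0.
have lim i : exists l, forall s, 0 <= s -> `|D s i 0 - l| <= h s.
  apply: (squeeze_limit (dg := fun s => dD s i 0) _ dhE) => // s s0.
    by have dDs := dDE s s0; exact: is_derive_coord.
  exact: dDh.
have [G HG] := choice lim.
pose Gamma : 'cV[R]_n := \col_i G i.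
pose M := n%:R * c2.
have bound s : 0 <= s ->
    enorm (C s - E (sigma s) *m Gamma) <= M * expR (- alpha * sigma s).
  move=> s0.
  have -> : C s - E (sigma s) *m Gamma = E (sigma s) *m (D s - Gamma).
    by rewrite mulmxBr /D mulmxA expmxNK mul1mx.
  rewrite /E enorm_expmx//.
  have : enorm (D s - Gamma) <= n%:R * h s.
    apply: le_trans (enorm_le_sum _) _.
    apply: (@le_trans _ _ (\sum_(i < n) h s)).
      apply: ler_sum => i _.
      have -> : (D s - Gamma) i 0 = D s i 0 - G i.
        by rewrite [LHS]mxE [X in _ + X]mxE [X in _ - X]mxE.
      exact: HG.
    by rewrite sumr_const card_ord mulr_natl.
  rewrite -(ler_pM2l (expR_gt0 (alpha * sigma s))) => H; apply: le_trans H _.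
  rewrite le_eqVlt; apply/orP; left; apply/eqP.
  rewrite /h /M (_ : - (2 * alpha) * sigma s =
      - (alpha * sigma s) + - alpha * sigma s);
    last by ring.
  rewrite expRD expRN; field.
  by rewrite gt_eqF// expR_gt0.
exists Gamma; last by exists M.
(* if [Gamma = 0], then [x] is bounded by [X] along the orbit, where
   [sigma >= 0] *)
apply/negP => /eqP G0.
pose X := (alpha ^+ 2 + L ^+ 2) * M ^+ 2.
have : \forall s \near +oo,
    0 <= s /\ Num.max 0 (sigma 0 + X / (2 * alpha)) <= sigma s.
  near=> s; split; first by near: s; exact: nbhs_pinfty_ge.
  by near: s; move/cvgryPge : sigma_cvgy; exact.
move=> /filter_ex[s [s0]]; rewrite ge_max => /andP[sig0 sigX].
have := bound s s0; rewrite G0 mulmx0 subr0 => CM.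
have M0 : 0 <= M by rewrite mulr_ge0.
have {}CM : enorm (C s) <= M.
  apply: le_trans CM _; rewrite ler_piMr//.
  by rewrite -expR0 ler_expR mulNr oppr_le0 mulr_ge0 ?(ltW alpha_gt0).
have CM2 : dotv (C s) (C s) <= M ^+ 2.
  by rewrite -sqr_enorm ler_pXn2r ?nnegrE ?enorm_ge0.
have xX : x s <= X.
  have -> : x s = alpha ^+ 2 * dotv (C s) (C s) + dotv (A *m C s) (A *m C s).
    rewrite /x avecE !dotv_bilinE (dotvC (A *m _) (C s)) dotv_antisym0//.
    by ring.
  have := L_bound (C s) => LC.
  have : (alpha ^+ 2 + L ^+ 2) * dotv (C s) (C s) <= X.
    by rewrite ler_wpM2l ?addr_ge0 ?sqr_ge0.
  lra.
have := r_growth s0; rewrite -(ler_pXn2r (ltn0Sn 1)) ?nnegrE ?expR_ge0// rE.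
have -> : expR (alpha * (sigma s - sigma 0)) ^+ 2 =
    expR (2 * alpha * (sigma s - sigma 0)).
  by rewrite expr2 -expRD; congr expR; ring.
have := expR_ge1Dx (2 * alpha * (sigma s - sigma 0)).
have : X / (2 * alpha) <= sigma s - sigma 0 by lra.
rewrite ler_pdivrMr ?mulr_gt0//.
lra.
Unshelve. all: by end_near. Qed.

End asymptotics.
End soliton.

Theorem lemma7p7 (R : realType) (n : nat) (A : 'M[R]_n) (alpha : R)
    (A_antisym : A^T = - A) (alpha_neq0 : alpha != 0) :
  (0 < alpha ->
    exists K0 : R, forall K : R, K0 <= K ->
      [/\ forward_invariant alpha A (region_plus alpha A K),
          backward_invariant alpha A (region_minus alpha A K) &
          forall (C T : R -> 'cV[R]_n) (sigma : R -> R),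
            soliton_orbit alpha A `[0, +oo[ C T ->
            (forall s : R, 0 <= s -> region_plus alpha A K (C s, T s)) ->
            sigma_param alpha A C sigma ->
            sigma s @[s --> +oo] --> +oo /\
            exists2 Gamma : 'cV[R]_n, Gamma != 0 &
              exists M : R, \forall s \near +oo,
                enorm (C s - expmx (sigma s *: (alpha%:M + A)) *m Gamma)
                  <= M * expR (- alpha * sigma s)])
  /\
  (alpha < 0 ->
    exists K0 : R, forall K : R, K0 <= K ->
      forall (C T : R -> 'cV[R]_n) (sigma : R -> R),
        soliton_orbit alpha A `[0, +oo[ C T ->
        (forall s : R, 0 <= s -> region_minus alpha A K (C s, T s)) ->
        sigma_param alpha A C sigma ->
        sigma s @[s --> +oo] --> +oo /\
        exists2 Gamma : 'cV[R]_n, Gamma != 0 &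
          exists M : R, \forall s \near +oo,
            enorm (C s - expmx (- sigma s *: (alpha%:M + A)) *m Gamma)
              <= M * expR (alpha * sigma s)).
Proof.
split=> alpha_sgn.
  have [L L_bound] := dotv_mulmx_bound A.
  have [K0 HK0] := admissible_large L alpha_neq0.
  exists K0 => K /HK0 K_adm; split.
  - move=> J C T orb s0 s1 s0J s1J s01.
    apply: (region_plus_invariant A_antisym L_bound) => //.
    by move=> s ss; apply: orb; exact: (@interval_is_interval _ J _ _ s0J s1J).
  (* time reversal [C (- s)], [- T (- s)] *)
  - move=> J C T orb s0 s1 s0J s1J s10 /region_minusN HT.
    apply/region_minusN.
    have := @region_plus_invariant _ _ _ _ A_antisym _ L_bound alpha_sgn _ K_adm
      (fun s => C (- s)) (fun s => - T (- s)) (- s0) (- s1).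
    rewrite !opprK lerN2; apply=> // s /andP[ss0 ss1].
    have sJ : - s \in J.
      apply: (@interval_is_interval _ J _ _ s1J s0J).
      by rewrite lerNr ss1 lerNl.
    have [T1 dC dT] := orb _ sJ.
    have dN : is_derive s 1 -%R (-1 : R) by exact: is_deriveNid.
    split.
    + by rewrite enormN.
    + by rewrite -scaleN1r; exact: is_derive_mx_comp.
    + have := is_deriveN (is_derive_mx_comp dT dN); congr is_derive.
      rewrite scaleN1r opprK /proj_orth enormN !dotv_bilinE.
      by rewrite mulNr scalerN scaleNr opprK.
  - move=> C T sigma orb reg dsigma.
    have dC (s : R) : 0 <= s -> is_derive s 1 C (T s).
      by move=> s0; have [] := orb s; rewrite ?in_itv/= ?s0.
    split; first exact: (sigma_cvgy A_antisym L_bound alpha_sgn K_adm dC reg).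
    have [Gamma G0 [M HM]] :=
      soliton_asymptotics A_antisym L_bound alpha_sgn K_adm dC reg dsigma.
    exists Gamma => //; exists M; near=> s; apply: HM.
    by near: s; exact: nbhs_pinfty_ge.
(* the case [alpha < 0] is the previous one for [- alpha] and [- A] *)
have A_antisym' : (- A)^T = - - A by rewrite linearN/= A_antisym.
have alpha0 : 0 < - alpha by rewrite oppr_gt0.
have [L L_bound] := dotv_mulmx_bound (- A).
have [K0 HK0] := admissible_large L (lt0r_neq0 alpha0).
exists K0 => K /HK0 K_adm C T sigma orb reg dsigma.
have BN : (- alpha)%:M - A = - (alpha%:M + A) by rewrite raddfN opprD.
have avecN c : avec (- alpha) (- A) c = - avec alpha A c.
  by rewrite /avec BN mulNmx.
have dC (s : R) : 0 <= s -> is_derive s 1 C (T s).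
  by move=> s0; have [] := orb s; rewrite ?in_itv/= ?s0.
have reg' s : 0 <= s -> region_plus (- alpha) (- A) K (C s, T s).
  move=> /reg; rewrite /region_plus /region_minus/= /nu.
  have -> : mu (- alpha) (- A) (C s) (T s) = - mu alpha A (C s) (T s).
    by rewrite /mu /ahat avecN enormN scalerN dotvNl.
  by rewrite avecN enormN sqrrN oppr_gt0.
have dsigma' : sigma_param (- alpha) (- A) C sigma.
  by move=> s s0; rewrite avecN enormN; exact: dsigma.
split; first exact: (sigma_cvgy A_antisym' L_bound alpha0 K_adm dC reg').
have [Gamma G0 [M HM]] :=
  soliton_asymptotics A_antisym' L_bound alpha0 K_adm dC reg' dsigma'.
exists Gamma => //; exists M; near=> s.
have := HM s; rewrite opprK BN scalerN -scaleNr; apply.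
by near: s; exact: nbhs_pinfty_ge.
Unshelve. all: by end_near. Qed.
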